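(* Let $G$ be a non-bipartite graph with $e$ edges and odd girth $g$. If every edge of $G$ is contained in the same number of cycles of length $g$, then $$\mathrm{mc}(G) \leq e\left(1-\frac{1}{g}\right).$$
   Context: All graphs are finite, simple and undirected. The odd girth of a non-bipartite graph is the length of a shortest odd cycle. For a graph $G$ with vertex set $V$ and disjoint $S,T\subseteq V$, $e(S,T)$ denotes the number of edges with one endpoint in $S$ and the other in $T$, and $S^c=V\setminus S$. The max-cut of $G$ is $\mathrm{mc}(G)=\max_{S\subset V} e(S,S^c)$. ''Cycles of length $g$'' are counted as subgraphs of $G$. *)

(* Defs.v *)
From mathcomp Require Import all_boot all_order all_algebra.

Set Implicit Arguments.
Unset Strict Implicit.
Unset Printing Implicit Defensive.

Record sgraph := SGraph {
  vertex :> finType;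
  adj : rel vertex;
  adj_sym : symmetric adj;
  adj_irrefl : irreflexive adj
}.

(* Undirected edges are unordered pairs of adjacent vertices. *)
Definition edges (G : sgraph) : {set {set G}} :=
  [set a : {set G} | [exists x : G, exists y : G, adj x y && (a == [set x; y])]].

Definition edges_between (G : sgraph) (S T : {set G}) : {set {set G}} :=
  [set a in edges G | [exists x in S, exists y in T, a == [set x; y]]].

Definition maxcut (G : sgraph) : nat :=
  \max_(S : {set G}) #|edges_between S (~: S)|.

Definition bipartite (G : sgraph) : Prop :=
  exists S : {set G}, forall x y : G, adj x y -> (x \in S) != (y \in S).

Definition cyclic_edges (G : sgraph) (p : seq G) : {set {set G}} :=
  [set [set x; next p x] | x in p].

(* The cycles of length k as subgraphs, each represented by its edge set. This
   set determines the subgraph, as a cycle has no isolated vertex, and does not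
   depend on a choice of starting vertex or of orientation. *)
Definition cycles (G : sgraph) (k : nat) : {set {set {set G}}} :=
  [set C : {set {set G}} | (2 < k) &&
     [exists p : k.-tuple G, ucycleb (@adj G) p && (C == cyclic_edges p)]].

Definition is_odd_girth (G : sgraph) (g : nat) : Prop :=
  [/\ odd g, cycles G g != set0
    & forall k : nat, odd k -> cycles G k != set0 -> g <= k].

(* Main.v *)
Require Import Defs.
From mathcomp Require Import all_boot all_order all_algebra.
Import Order.TTheory GRing.Theory Num.Theory.
Local Open Scope ring_scope.

(** Fix a cut [S] and count the pairs made of a shortest odd cycle and one of
    its edges.  Going once around an odd cycle, one cannot change sides at every
    step, so each cycle has an edge that the cut misses
    ([odd_cycle_meets_uncut_edges]).  Let N be the number of cycles of length g
    and m the common number of these cycles through an edge.  The pairs whose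
    edge is arbitrary number e m and are at most g N, since a cycle has at most
    g edges; the pairs whose edge is uncut number m (e - c), where c is the size
    of the cut, and are at least N.  Hence e m <= g m (e - c), and m is positive
    because some cycle of length g exists and it has an edge.  Dividing by m
    gives e <= g (e - c), which is the claim c <= e (1 - 1 / g). *)

Lemma double_count_incidences (T : finType) (F : {set {set T}}) (A : {set T}) :
  (\sum_(C in F) #|C :&: A| = \sum_(a in A) #|[set C in F | a \in C]|)%N.
Proof.
transitivity (\sum_(C in F) \sum_(a in A) (a \in C))%N.
  apply: eq_bigr => C _; rewrite -sum1_card big_mkcond [RHS]big_mkcond /=.
  by apply: eq_bigr => a _; rewrite inE; case: (a \in C); case: (a \in A).
rewrite exchange_big /=; apply: eq_bigr => a _.
rewrite -sum1_card big_mkcond [RHS]big_mkcond /=.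
by apply: eq_bigr => C _; rewrite inE; case: (C \in F); case: (a \in C).
Qed.

Lemma alternating_path_last (T : Type) (f : T -> bool) (x : T) (p : seq T) :
  path (fun y z => f y != f z) x p -> f (last x p) = f x (+) odd (size p).
Proof.
elim: p x => [|y p IHp] x /=; first by rewrite addbF.
by case/andP=> + /IHp ->; case: (f x); case: (f y); case: (odd _).
Qed.

(** A two-colouring that changes at every step around a closed walk changes an
    even number of times. *)
Lemma odd_cycle_has_monochromatic_step
    (T : eqType) (f : T -> bool) (p : seq T) :
  uniq p -> odd (size p) -> exists2 x, x \in p & f x = f (next p x).
Proof.
move=> Up odd_p.
have [/hasP[x xp /eqP fx] | /hasPn alternating] :=
  boolP (has (fun x => f x == f (next p x)) p); first by exists x.
have: cycle (fun y z => f y != f z) p by exact: cycle_from_next.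
case: p odd_p {Up alternating} => //= x p odd_p steps.
have := alternating_path_last _ f x (rcons p x) steps.
by rewrite last_rcons size_rcons /= odd_p addbT; case: (f x).
Qed.

Lemma pair_notin_edges_between (G : sgraph) (S : {set G}) (x y : G) :
  (x \in S) = (y \in S) -> [set x; y] \notin edges_between S (~: S).
Proof.
move=> xyS; rewrite inE negb_and; apply/orP; right; apply/negP.
case/existsP=> u /andP[uS /existsP[v /andP[]]].
rewrite inE => vS /eqP xyE.
have: u \in [set x; y] by rewrite xyE set21.
have: v \in [set x; y] by rewrite xyE set22.
by rewrite !inE => /orP[]/eqP vE /orP[]/eqP uE; subst u v;
  move: uS vS; rewrite ?xyS => ->.
Qed.

Lemma card_cycle_leq (G : sgraph) (k : nat) (C : {set {set G}}) :
  C \in cycles G k -> (#|C| <= k)%N.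
Proof.
rewrite inE => /andP[_ /existsP[p /andP[_ /eqP->]]].
apply: leq_trans (leq_imset_card _ _) _.
by rewrite -[leqRHS](size_tuple p) card_size.
Qed.

Lemma odd_cycle_meets_uncut_edges (G : sgraph) (k : nat) (S : {set G})
    (C : {set {set G}}) :
  odd k -> C \in cycles G k ->
  exists2 a, a \in C & a \in edges G :\: edges_between S (~: S).
Proof.
move=> odd_k; rewrite inE => /andP[_ /existsP[p /andP[/andP[cyc_p Up] /eqP->]]].
have [|x xp xS] := @odd_cycle_has_monochromatic_step _ (mem S) p Up.
  by rewrite size_tuple.
exists [set x; next p x]; first exact: imset_f.
rewrite inE pair_notin_edges_between //= inE.
by apply/existsP; exists x; apply/existsP; exists (next p x);
  rewrite eqxx andbT (next_cycle cyc_p).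
Qed.

Lemma edges_between_subset (G : sgraph) (S T : {set G}) :
  edges_between S T \subset edges G.
Proof. by apply/subsetP=> a; rewrite inE => /andP[]. Qed.

(** This is the double count.  If each edge lies on [m] of the cycles, then the
    incidences with all edges and with uncut edges both come with a factor [m],
    and a single cycle already meets the inequality between them: it has at most
    [k] edges, and at least one of them is uncut. *)
Lemma card_edges_leq_uncut (G : sgraph) (k : nat) (S : {set G}) :
  odd k -> cycles G k != set0 ->
  (forall a b : {set G}, a \in edges G -> b \in edges G ->
     #|[set C in cycles G k | a \in C]| = #|[set C in cycles G k | b \in C]|) ->
  (#|edges G| <= k * #|edges G :\: edges_between S (~: S)|)%N.
Proof.
move=> odd_k /set0Pn[C0 C0k] regular.
set U := edges G :\: _.
have [a0 a0C0] := odd_cycle_meets_uncut_edges _ _ S _ odd_k C0k.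
rewrite inE => /andP[_ a0E].
pose m := #|[set C in cycles G k | a0 \in C]|.
have m_gt0 : (0 < m)%N by apply/card_gt0P; exists C0; rewrite inE C0k.
have incidences (A : {set {set G}}) : A \subset edges G ->
    (\sum_(C in cycles G k) #|C :&: A| = #|A| * m)%N.
  move=> /subsetP sAE; rewrite double_count_incidences -sum_nat_const.
  by apply: eq_bigr => a /sAE aE; apply: regular.
(* After multiplying by [m], both sides are sums over the cycles. *)
rewrite -(leq_pmul2r m_gt0) -mulnA -!incidences ?subsetDl // big_distrr /=.
apply: leq_sum => C Ck; apply: leq_trans (subset_leq_card (subsetIl _ _)) _.
apply: leq_trans (card_cycle_leq _ _ _ Ck) _; apply: leq_pmulr.
have [a aC aU] := odd_cycle_meets_uncut_edges _ _ S _ odd_k Ck.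
by apply/card_gt0P; exists a; rewrite inE aC.
Qed.

Theorem theorem2p1 (G : sgraph) (g : nat) :
  ~ bipartite G ->
  is_odd_girth G g ->
  (forall a b : {set G}, a \in edges G -> b \in edges G ->
     #|[set C in cycles G g | a \in C]| = #|[set C in cycles G g | b \in C]|) ->
  (maxcut G)%:R <= #|edges G|%:R * (1 - (g%:R)^-1) :> rat.
Proof.
move=> _ [odd_g cycles_neq0 _] regular; rewrite /maxcut.
have [|S ->] := @bigop.eq_bigmax {set G} (fun S => #|edges_between S (~: S)|).
  by apply/card_gt0P; exists set0.
have := card_edges_leq_uncut _ _ S odd_g cycles_neq0 regular.
rewrite cardsD (setIidPr (edges_between_subset _ _ _)).
rewrite -(ler_nat rat) natrM natrB ?subset_leq_card ?edges_between_subset //.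
have g_gt0 : 0 < g%:R :> rat by rewrite ltr0n odd_gt0.
rewrite mulrC -ler_pdivrMr // => uncut_ge.
by rewrite mulrBr mulr1 lerBrDr -lerBrDl.
Qed.
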